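(* Let $(X,+,d)$ be a metric Abelian group, let $n_0\in\mathbb{N}$ be such that $\mu_d(n_0)>1$ and let $D\subseteq X$ be a closed bounded $n_0$-convex set. Let $f:D\to\mathbb{R}$ be $(T,t)$-convex for some $(T,t)\in\mathcal{E}^d(X)\times\,]0,1[$, and let $n\in\mathbb{N}$ be such that $\pi_n$ is a bijection with a $d$-bounded inverse. Then, for all $k\in\{1,\dots,n\}$, $f$ is also $(\pi_n^{-1}\circ\pi_k,\,n^{-1}k)$-convex.
   Context: A metric Abelian group $(X,+,d)$ is an Abelian group with a translation invariant metric $d$; $\|x\|_d:=d(x,0)$. $\mathcal{E}(X)$ is the ring of all endomorphisms of $X$ and $I$ is the identity. $T\in\mathcal{E}(X)$ is $d$-bounded if there is $c\geq0$ with $\|T(x)\|_d\leq c\|x\|_d$ for all $x\in X$; $\mathcal{E}^d(X)$ is the set of $d$-bounded endomorphisms. For $n\in\mathbb{N}$, $n\cdot x$ denotes $x+\dots+x$ ($n$ terms), $\pi_n(x):=n\cdot x$, and $\mu_d(n)$ is the largest number such that $\mu_d(n)\|x\|_d\leq\|n\cdot x\|_d$ for all $x\in X$. A set $A\subseteq X$ is $n$-convex if $\{n\cdot x\mid x\in A\}=\{x_1+\dots+x_n\mid x_1,\dots,x_n\in A\}$. For $T\in\mathcal{E}(X)$, a set $D\subseteq X$ is $T$-convex if $T(x)+(I-T)(y)\in D$ for all $x,y\in D$. For $(T,t)\in\mathcal{E}(X)\times[0,1]$, a function $f:D\to\mathbb{R}$ is $(T,t)$-convex if $D$ is $T$-convex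 and $f(T(x)+(I-T)(y))\leq tf(x)+(1-t)f(y)$ for all $x,y\in D$. *)

(* Defs.v *)
From HB Require Import structures.
From mathcomp Require Import all_boot all_order all_algebra.
(* Restricted to `ereal` and `topology`: once the normed structures of
   mathcomp-analysis are loaded, HB rejects the structure below for want of a
   join that can no longer be declared. *)
From mathcomp Require Import all_classical all_reals ereal topology.

Set Implicit Arguments.
Unset Strict Implicit.
Unset Printing Implicit Defensive.

Import Order.TTheory GRing.Theory Num.Theory.

Local Open Scope classical_set_scope.
Local Open Scope ring_scope.

HB.mixin Record isTranslationInvariant (R : numDomainType) X
    & Metric R X & GRing.Zmodule X := {
  mdistDr : forall z x y : X, mdist (x + z) (y + z) = mdist x y
}.

#[short(type="metricZmodType")]
HB.structure Definition MetricZmodule (R : numDomainType) :=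
  { X of Metric R X & GRing.Zmodule X & isTranslationInvariant R X }.

Section MetricAbelianGroup.
Context {R : realType} {X : metricZmodType R}.
Implicit Types (D A : set X) (f : X -> R) (t : R) (n : nat) (T : {additive X -> X}).

(* Not a norm in the sense of the library, which would require
   `|x *+ n| = `|x| *+ n. *)
Definition dnorm (x : X) : R := mdist x 0.

Definition metric_bounded D :=
  exists M : R, forall x y, D x -> D y -> mdist x y <= M.

Definition d_bounded T :=
  exists2 c : R, 0 <= c & forall x, dnorm (T x) <= c * dnorm x.

Definition nmul n (x : X) : X := x *+ n.

Fact nmul_is_zmod_morphism n : zmod_morphism (nmul n).
Proof. by move=> x y; rewrite /nmul mulrnBl. Qed.

HB.instance Definition _ n :=
  GRing.isZmodMorphism.Build X X (nmul n) (nmul_is_zmod_morphism n).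

Fact inv_endo_subproof T : bijective T ->
  exists S : {additive X -> X}, cancel T S /\ cancel S T.
Proof.
case=> S TK SK.
have SB : zmod_morphism S.
  by move=> x y; apply: (can_inj TK); rewrite raddfB !SK.
pose SM := GRing.isZmodMorphism.Build X X S SB.
by exists (HB.pack_for {additive X -> X} S SM).
Qed.

Definition inv_endo T (bijT : bijective T) : {additive X -> X} :=
  sval (cid (inv_endo_subproof bijT)).

Lemma inv_endoK T (bijT : bijective T) : cancel T (inv_endo bijT).
Proof. by rewrite /inv_endo; case: cid => S []. Qed.

Lemma inv_endoVK T (bijT : bijective T) : cancel (inv_endo bijT) T.
Proof. by rewrite /inv_endo; case: cid => S []. Qed.

(* The largest c with c * dnorm x <= dnorm (x *+ n) for all x. If X has a
   nonzero element this supremum is finite and attained (`mu_fin_num`, `mu_le`);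
   in the trivial group every c qualifies and the value is +oo. *)
Definition mu n : \bar R :=
  ereal_sup [set c%:E | c in [set c : R | forall x : X, c * dnorm x <= dnorm (x *+ n)]].

Lemma dnorm_ge0 (x : X) : 0 <= dnorm x. Proof. exact: mdist_ge0. Qed.

Lemma dnorm_gt0 (x : X) : x != 0 -> 0 < dnorm x.
Proof.
move=> x0; rewrite lt_neqAle dnorm_ge0 andbT eq_sym.
by apply: contra x0 => /eqP/mdist_positivity ->.
Qed.

Lemma mu_ge0 n : (0 <= mu n)%E.
Proof.
by apply: ereal_sup_ubound; exists 0 => // x; rewrite mul0r dnorm_ge0.
Qed.

Lemma mu_ub n (x : X) : x != 0 -> (mu n <= (dnorm (x *+ n) / dnorm x)%:E)%E.
Proof.
move=> x0; apply: ge_ereal_sup => _ [c /= cP <-].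
by rewrite lee_fin ler_pdivlMr ?dnorm_gt0.
Qed.

Lemma mu_fin_num n (x : X) : x != 0 -> mu n \is a fin_num.
Proof.
move=> x0; apply/fin_numPlt; rewrite (lt_le_trans _ (mu_ge0 n)) ?ltNyr//=.
by rewrite (le_lt_trans (mu_ub n x0)) ?ltry.
Qed.

Lemma mu_le n (x : X) : fine (mu n) * dnorm x <= dnorm (x *+ n).
Proof.
have [->|x0] := eqVneq x 0.
  have d0 : dnorm (0 : X) = 0 by exact: mdistxx.
  by rewrite mul0rn d0 mulr0.
rewrite -ler_pdivlMr ?dnorm_gt0// -lee_fin fineK ?(mu_fin_num _ x0)//.
exact: mu_ub.
Qed.

Definition n_convex n A :=
  [set x *+ n | x in A] =
  [set \sum_(i < n) u i | u in [set u : 'I_n -> X | forall i, A (u i)]].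

Definition T_convex T D :=
  forall x y, D x -> D y -> D (T x + (idfun \- T) y).

(* A function on D is represented by a total f : X -> R of which only the
   values on D matter. *)
Definition Tt_convex T t D f :=
  [/\ 0 <= t <= 1, T_convex T D &
      forall x y, D x -> D y ->
        f (T x + (idfun \- T) y) <= t * f x + (1 - t) * f y].

End MetricAbelianGroup.

Arguments nmul {R} X n x.
Arguments mu {R} X n.

(* Main.v *)
Require Import Defs.
From mathcomp Require Import all_boot all_order all_algebra.
From mathcomp Require Import all_classical all_reals ereal topology.
From mathcomp Require Import zify lra.

Import Order.TTheory GRing.Theory Num.Theory.

Local Open Scope classical_set_scope.
Local Open Scope ring_scope.

(** Given [x, y] in [D], divisibility by [n] provides [e] with
    [x = y + n e], and the point to be reached is [y + k e].

    The whole progression [y + j e], [j <= n], lies in [D]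
    ([closed_n_convex_progression]). Indeed, put [N = n0 ^ m]. Then [D] is
    also [N]-convex, so the sum of [a] copies of [x] and [N - a] copies of [y]
    is [N w] for some [w] in [D]. With [N = q n + r], [r < n], and [a = q j],
    this sum differs from [N (y + j e)] by [r j e] only, whose norm is bounded
    independently of [m]. As multiplication by [N] expands norms by a factor
    [c ^ m] with [c > 1], the points [w] converge to [y + j e], and [D] is
    closed.

    On its side, [f] satisfies the midpoint inequality
    [2 f m <= f a + f b] whenever [a, b, m] are points of [D] with
    [2 m = a + b] ([Tt_convex_midpoint]). This follows from writing [m] as a
    [T]-combination of two points which are themselves [T]-combinations
    of [m] with [b] and of [a] with [m].

    Three consecutive terms of the progression satisfy [2 m = a + b], so the
    sequence [f (y + j e)] has nonnegative second differences; hence it lies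
    below the chord joining its ends ([discrete_convex_chord]), and this is
    the claim. *)

(** * Growth and discrete convexity of real sequences *)

Lemma mulrn_le_exprn (R : realDomainType) (c : R) m :
  1 <= c -> (c - 1) *+ m <= c ^+ m.
Proof.
move=> c1; elim: m => [|m IH]; first by rewrite mulr0n expr0 ler01.
have c1m : 1 <= c ^+ m by rewrite exprn_ege1.
by rewrite mulrSr exprS; nra.
Qed.

Lemma exprn_unbounded (R : archiRealFieldType) (c M : R) :
  1 < c -> exists m, M < c ^+ m.
Proof.
move=> c1; exists (Num.truncn (M / (c - 1))).+1.
apply: lt_le_trans (mulrn_le_exprn _ _ _ (ltW c1)).
by rewrite -mulr_natl -ltr_pdivrMr ?subr_gt0// truncnS_gt.
Qed.

(** The slopes [(a k - a 0) / k] are nondecreasing: the increments of [a]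
    are, and [(a k - a 0) / k] is the mean of the first [k] of them. *)
Lemma discrete_convex_slope (R : realFieldType) (a : nat -> R) n :
  (forall j, (j.+1 < n)%N -> 2 * a j.+1 <= a j + a j.+2) ->
  forall k, (k < n)%N -> a k - a 0%N <= k%:R * (a k.+1 - a k).
Proof.
move=> conv; elim=> [|k IH] kn; first by rewrite subrr mul0r.
have := IH (ltnW kn); have := conv _ kn; rewrite -[k.+1%:R]natr1.
have : 0 <= k%:R :> R by [].
move: (k%:R) => r r0; nra.
Qed.

(** The slope from [0] to [n] is nondecreasing in [n]; start from [n = k]. *)
Lemma discrete_convex_chord (R : realFieldType) (a : nat -> R) n :
  (forall j, (j.+1 < n)%N -> 2 * a j.+1 <= a j + a j.+2) ->
  forall k, (k <= n)%N -> n%:R * (a k - a 0%N) <= k%:R * (a n - a 0%N).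
Proof.
elim: n => [|n IH] conv k; first by rewrite leqn0 => /eqP ->; rewrite !mul0r.
rewrite leq_eqVlt => /orP[/eqP -> //|]; rewrite ltnS => kn.
have {}IH : n%:R * (a k - a 0%N) <= k%:R * (a n - a 0%N).
  by apply: IH => // j jn; apply: conv; exact: ltnW.
have := discrete_convex_slope _ _ _ conv n (ltnSn n).
case: n kn IH {conv} => [|n] kn IH sl.
  by move: kn; rewrite leqn0 => /eqP ->; rewrite subrr mulr0 mul0r.
have n0 : 0 < n.+1%:R :> R by [].
have k0 : 0 <= k%:R :> R by [].
rewrite -(ler_pM2l n0) -[n.+2%:R]natr1.
move: (n.+1%:R) (k%:R) n0 k0 IH sl => p r p0 r0 IH sl; nra.
Qed.

(** * Norms in metric Abelian groups *)

Section Norm.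
Context {R : realType} {X : metricZmodType R}.
Implicit Types (x y : X) (n m : nat).

Lemma mdistE x y : mdist x y = dnorm (x - y).
Proof. by rewrite /dnorm -(mdistDr (- y)) subrr. Qed.

Lemma dnormD x y : dnorm (x + y) <= dnorm x + dnorm y.
Proof.
rewrite [leLHS]/dnorm; apply: le_trans (metric_triangle _ y _) _.
by rewrite mdistE addrK.
Qed.

Lemma dnormMn x n : dnorm (x *+ n) <= dnorm x *+ n.
Proof.
elim: n => [|n IH]; first by rewrite !mulr0n /dnorm mdistxx.
by rewrite !mulrS (le_trans (dnormD _ _))// lerD2l.
Qed.

Lemma mu_gt1_expand n : (1%:E < mu X n)%E ->
  exists2 c : R, 1 < c & forall m x, c ^+ m * dnorm x <= dnorm (x *+ n ^ m).
Proof.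
move=> /ereal_sup_gt [_ [c /= cP <-]]; rewrite lte_fin => c1.
exists c => //; elim=> [|m IH] x; first by rewrite expr0 mul1r expn0 mulr1n.
rewrite exprS -mulrA expnSr mulrnA.
apply: le_trans (cP _); rewrite ler_pM2l ?IH//.
exact: lt_trans c1.
Qed.

Lemma closed_approx (D : set X) x : closed D ->
  (forall e : R, 0 < e -> exists2 w, D w & dnorm (x - w) < e) -> D x.
Proof.
move=> closedD approx; apply: closedD => B /nbhs_ballP[e /= e0 eB].
have [w Dw xw] := approx e e0.
by exists w; split=> //; apply: eB; rewrite ballEmdist /= mdistE.
Qed.

End Norm.

(** * Convex sets *)

Section ConvexSet.
Context {R : realType} {X : metricZmodType R}.
Implicit Types (D : set X) (x y e : X).

Lemma n_convex_sum n D (u : nat -> X) : n_convex n D ->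
  (forall i, D (u i)) -> exists2 w, D w & \sum_(0 <= i < n) u i = w *+ n.
Proof.
move=> convD Du.
have : [set \sum_(i < n) v i | v in [set v : 'I_n -> X | forall i, D (v i)]]
         (\sum_(0 <= i < n) u i).
  by exists (fun i => u i) => [i //|]; rewrite big_mkord.
by rewrite -convD => -[w Dw <-]; exists w.
Qed.

(** A sum of [n ^ m.+1] points splits into [n] blocks, each of which is
    [n ^ m] times a point of [D]. *)
Lemma n_convex_exp_sum n m D (u : nat -> X) : n_convex n D ->
  (forall i, D (u i)) ->
  exists2 w, D w & \sum_(0 <= i < n ^ m) u i = w *+ n ^ m.
Proof.
move=> convD; elim: m u => [|m IH] u Du.
  by exists (u 0%N) => //; rewrite expn0 big_nat1 mulr1n.
have block i : exists w, D w /\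
    \sum_(i * n ^ m <= j < i.+1 * n ^ m) u j = w *+ n ^ m.
  have [//|w Dw E] := IH (fun j => u (j + i * n ^ m)%N).
  exists w; split=> //; rewrite -E -{1}[(i * _)%N]add0n big_addn.
  by rewrite mulSn addnK.
have [v Dv] := choice block.
have [w Dw E] := n_convex_sum n D v convD (fun i => (Dv i).1).
exists w => //; rewrite expnS big_nat_mul mulrnA -E -sumrMnl.
by apply: eq_bigr => i _; rewrite (Dv i).2.
Qed.

Lemma n_convex_two_points n m D x y a : n_convex n D -> D x -> D y ->
  (a <= n ^ m)%N -> exists2 w, D w & x *+ a + y *+ (n ^ m - a) = w *+ n ^ m.
Proof.
move=> convD Dx Dy aN.
have [|w Dw wE] := n_convex_exp_sum n m D (fun i => if (i < a)%N then x else y)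
  convD; first by move=> i; case: ifP.
exists w => //; rewrite -wE (big_cat_nat (n := a))//=; congr (_ + _).
  rewrite big_nat (eq_bigr (fun=> x)) => [|i /= ->//].
  by rewrite -big_nat sumr_const_nat subn0.
rewrite big_nat (eq_bigr (fun=> y)) => [|i /andP[/leq_gtF -> //]].
by rewrite -big_nat sumr_const_nat.
Qed.

(** Modulo the error [r j e], [r < n], the multiple of [y + j e] by
    [N = n0 ^ m] is a sum of [N] copies of the two ends, hence [N] times a
    point [w] of [D]. Since multiplication by [N] expands norms without bound
    as [m] grows, [w] gets arbitrarily close to [y + j e]. *)
Lemma closed_n_convex_progression n0 D y e n j :
  (1%:E < mu X n0)%E -> closed D -> n_convex n0 D ->
  D y -> D (y + e *+ n) -> (j <= n)%N -> D (y + e *+ j).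
Proof.
move=> /mu_gt1_expand[c c1 expand] closedD convD Dy Dx jn.
have [n0E|n_gt0] := posnP n; first by move: jn Dx; rewrite n0E leqn0 => /eqP ->.
apply: closed_approx => // eps eps0.
have [m cm] := exprn_unbounded _ c (dnorm e *+ (n * j) / eps) c1.
set N := (n0 ^ m)%N.
have qjN : (N %/ n * j <= N)%N.
  by apply: leq_trans (leq_trunc_div N n); rewrite leq_mul2l jn orbT.
have [w Dw wE] := n_convex_two_points n0 m D _ _ _ convD Dx Dy qjN.
exists w => //.
(* Euclidean division of N by n leaves only the remainder times j e. *)
have diffE : (y + e *+ j - w) *+ N = e *+ (N %% n * j).
  rewrite mulrnBl mulrnDl -wE mulrnDl [X in _ - X]addrAC -mulrnDr (subnKC qjN).
  rewrite opprD addrACA subrr add0r; apply/eqP.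
  rewrite subr_eq -!mulrnA -mulrnDr; apply/eqP; congr (_ *+ _).
  by rewrite {1}(divn_eq N n); lia.
have c0 : 0 < c ^+ m by rewrite exprn_gt0// (lt_trans _ c1).
rewrite -(ltr_pM2l c0); apply: le_lt_trans (expand _ _) _.
rewrite -/N diffE; apply: le_lt_trans (dnormMn _ _) _.
rewrite ltr_pdivrMr// in cm; apply: le_lt_trans cm.
apply: ler_wpMn2l; first exact: Defs.dnorm_ge0.
by rewrite leq_mul2r ltnW ?orbT// ltn_pmod.
Qed.

End ConvexSet.

(** * Convex functions *)

Section ConvexFunction.
Context {R : realType} {X : metricZmodType R}.
Implicit Types (D : set X) (f : X -> R) (T : {additive X -> X}).

Lemma T_combE T (x y : X) : T x + (idfun \- T) y = y + T (x - y).
Proof. by rewrite raddfB /= addrCA. Qed.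

(** With [p] and [q] the [T]-combinations of [m] with [b] and of [a] with [m],
    [p - q = b - m], so that the [T]-combination of [p] with [q] is
    [q + T (b - m) = m]. Applying the convexity of [f] three times bounds
    [f m] by [(t^2 + (1 - t)^2) f m + t (1 - t) (f a + f b)], and
    [t (1 - t)] can then be cancelled. *)
Lemma Tt_convex_midpoint T t D f (a b m : X) : 0 < t < 1 ->
  Tt_convex T t D f -> D a -> D b -> D m -> m *+ 2 = a + b ->
  2 * f m <= f a + f b.
Proof.
move=> /andP[t0 t1] [_ TD conv] Da Db Dm mE.
have amE : a - m = m - b.
  by apply/eqP; rewrite subr_eq addrAC -mulr2n mE addrK.
pose p := T m + (idfun \- T) b; pose q := T a + (idfun \- T) m.
have Dp : D p by exact: TD.
have Dq : D q by exact: TD.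
have pqE : T p + (idfun \- T) q = m.
  rewrite T_combE /p /q !T_combE amE opprD addrACA subrr addr0.
  by rewrite -addrA -raddfD addrA subrK subrr raddf0 addr0.
have := conv _ _ Dp Dq; rewrite pqE.
have := conv _ _ Dm Db; rewrite -/p.
have := conv _ _ Da Dm; rewrite -/q.
move: (f p) (f q) (f a) (f b) (f m) => P Q A B M hq hp hm.
have tt0 : 0 < t * (1 - t) by rewrite mulr_gt0 ?subr_gt0.
rewrite -(ler_pM2l tt0).
have : t * P <= t * (t * M + (1 - t) * B) by rewrite ler_pM2l.
have : (1 - t) * Q <= (1 - t) * (t * A + (1 - t) * M).
  by rewrite ler_pM2l ?subr_gt0.
lra.
Qed.

End ConvexFunction.

Theorem corollary5p16 (R : realType) (X : metricZmodType R)
  (n0 : nat) (n0_gt0 : (0 < n0)%N) (mu_gt1 : (1%:E < mu X n0)%E)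
  (D : set X) (closedD : closed D) (boundedD : metric_bounded D)
  (convexD : n_convex n0 D)
  (f : X -> R) (T : {additive X -> X}) (t : R)
  (boundedT : d_bounded T) (t_itv : 0 < t < 1) (convexf : Tt_convex T t D f)
  (n : nat) (n_gt0 : (0 < n)%N) (bij_n : bijective (nmul X n))
  (bounded_inv : d_bounded (inv_endo bij_n)) :
  forall k : nat, (1 <= k <= n)%N ->
    Tt_convex (inv_endo bij_n \o nmul X k) (n%:R^-1 * k%:R) D f.
Proof.
move=> k /andP[_ kn].
have n0R : 0 < n%:R :> R by rewrite ltr0n.
pose step x y := inv_endo bij_n (x - y).
have step_end x y : y + step x y *+ n = x.
  by rewrite -[_ *+ n]/(nmul X n _) inv_endoVK addrC subrK.
have combE x y : (inv_endo bij_n \o nmul X k) x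
    + (idfun \- (inv_endo bij_n \o nmul X k)) y = y + step x y *+ k.
  by rewrite T_combE /= /step -raddfMn.
have Dstep x y j : D x -> D y -> (j <= n)%N -> D (y + step x y *+ j).
  move=> Dx Dy; apply: closed_n_convex_progression mu_gt1 _ _ _ _ => //.
  by rewrite step_end.
split.
- rewrite mulr_ge0 ?invr_ge0//= ler_pdivrMl// mulr1 ler_nat //.
- by move=> x y Dx Dy; rewrite combE; exact: Dstep.
move=> x y Dx Dy; rewrite combE.
pose a j := f (y + step x y *+ j).
have conv j : (j.+1 < n)%N -> 2 * a j.+1 <= a j + a j.+2.
  move=> jn; apply: (Tt_convex_midpoint T t D f) => //.
  - by apply: Dstep => //; rewrite ltnW// ltnW.
  - exact: Dstep.
  - by apply: Dstep => //; exact: ltnW.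
  rewrite mulrnDl -mulrnA [RHS]addrACA -mulrnDr -mulr2n; congr (_ + _ *+ _).
  lia.
have := discrete_convex_chord R a n conv k kn.
have -> : a 0%N = f y by rewrite /a mulr0n addr0.
have -> : a n = f x by rewrite /a step_end.
rewrite -ler_pdivlMl// mulrA -/(a k); lra.
Qed.
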